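(* For each $i \geq 5$, the net occurrences in $T_i$ are exactly the occurrences of the strings in $\mathcal{P}_i := \{ T_{i-2}, \ \overline{T_{i-2}}, \ T_{i-4} \ \overline{T_{i-3}}, \ \overline{T_{i-4}} \ T_{i-3} \}$; every occurrence of each of these strings is a net occurrence, and there are no other net occurrences in $T_i$. (Namely, $T_{i-2}$ occurs at positions $1$, $\tau_{i-2}+\tau_{i-3}+1$, $\tau_{i-1}+\tau_{i-2}+1$; $\overline{T_{i-2}}$ at $\tau_{i-2}+1$, $\tau_{i-1}+1$; $T_{i-4}\overline{T_{i-3}}$ at $\tau_{i-3}+\tau_{i-4}+1$, $\tau_{i-1}+\tau_{i-3}+1$; $\overline{T_{i-4}}T_{i-3}$ at $\tau_{i-3}+1$, $\tau_{i-1}+\tau_{i-3}+\tau_{i-4}+1$, giving exactly nine net occurrences.)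
   Context: Strings are over the binary alphabet $\{\texttt{a},\texttt{b}\}$. For a binary string $S$, $\overline{S}$ denotes the string obtained by simultaneously replacing each \texttt{a} with \texttt{b} and each \texttt{b} with \texttt{a}. The Thue-Morse word of order $i$ is $T_i$, where $T_1 := \texttt{a}$ and $T_i := T_{i-1}\overline{T_{i-1}}$ for $i \geq 2$; $\tau_i := |T_i| = 2^{i-1}$. An occurrence in a text $T$ is a pair of positions $(i,j)$; it is a net occurrence if $T[i\ldots j]$ occurs at least twice in $T$ while both $T[i-1\ldots j]$ and $T[i\ldots j+1]$ occur only once (when $i=1$ the left extension is taken to be unique; when $j=|T|$ the right extension is taken to be unique). *)

(* Defs.v *)
From mathcomp Require Import all_boot.

Set Implicit Arguments.
Unset Strict Implicit.
Unset Printing Implicit Defensive.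

(* Binary strings are [seq bool]: the letter a is [false], b is [true].
   Positions are 1-based natural numbers. *)

Definition compl (S : seq bool) : seq bool := [seq ~~ c | c <- S].

(* The sequence is indexed from 1; the value at 0 is junk. *)
Fixpoint TM (i : nat) : seq bool :=
  match i with
  | 0 => [::]
  | 1 => [:: false]
  | i'.+1 => TM i' ++ compl (TM i')
  end.

Definition tau (i : nat) : nat := size (TM i).

(* T[i .. j], for 1 <= i <= j <= |T|. *)
Definition factor (T : seq bool) (i j : nat) : seq bool :=
  take (j + 1 - i) (drop (i - 1) T).

Definition is_occ (T S : seq bool) (i j : nat) : bool :=
  [&& 1 <= i, i <= j, j <= size T & factor T i j == S].

Definition position_pairs (T : seq bool) : seq (nat * nat) :=
  [seq (i, j) | i <- iota 1 (size T), j <- iota 1 (size T)].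

Definition occs (T S : seq bool) : seq (nat * nat) :=
  [seq ij <- position_pairs T | is_occ T S ij.1 ij.2].

Definition starts (T S : seq bool) : seq nat := [seq ij.1 | ij <- occs T S].

Definition nb_occ (T S : seq bool) : nat := size (occs T S).

(* At the borders of T the missing extension counts as unique. *)
Definition net_occ (T : seq bool) (i j : nat) : bool :=
  [&& 1 <= i, i <= j, j <= size T,
      2 <= nb_occ T (factor T i j),
      (i == 1) || (nb_occ T (factor T (i - 1) j) == 1)
    & (j == size T) || (nb_occ T (factor T i (j + 1)) == 1)].

Definition net_occs (T : seq bool) : seq (nat * nat) :=
  [seq ij <- position_pairs T | net_occ T ij.1 ij.2].

Definition P_set (i : nat) : seq (seq bool) :=
  [:: TM (i - 2); compl (TM (i - 2));
      TM (i - 4) ++ compl (TM (i - 3));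
      compl (TM (i - 4)) ++ TM (i - 3)].

(* Main.v *)
(** The word [T_(n+1)] is the image of [T_n] under the morphism a -> ab, b -> ba.
    Since the Thue-Morse word has no three equal consecutive letters, two
    occurrences of a factor of length at least 5 start at positions of the same
    parity, and can both be extended to whole blocks of the morphism. Hence a net
    occurrence of length at least 5 in [T_(n+1)] is a union of blocks, and it is
    net exactly when its preimage in [T_n] is. Shorter net occurrences are
    excluded, because each of the six factors of length 3 already occurs twice
    in [T_5], so every factor of length at most 5 is repeated in [T_(n+1)] for
    [n >= 5]. The occurrences of the words of [P_n] double in the same way,
    which reduces everything to a computation in [T_5]. *)

Require Import Defs.
From mathcomp Require Import all_boot zify.

Set Implicit Arguments.
Unset Strict Implicit.
Unset Printing Implicit Defensive.

(** * The block morphism and the infinite Thue-Morse word *)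

Fixpoint morph (w : seq bool) : seq bool :=
  if w is x :: w' then [:: x, ~~ x & morph w'] else [::].

Lemma morph_cat u v : morph (u ++ v) = morph u ++ morph v.
Proof. by elim: u => //= x u ->. Qed.

Lemma morph_compl u : morph (compl u) = compl (morph u).
Proof. by elim: u => //= x u ->. Qed.

Lemma size_morph u : size (morph u) = 2 * size u.
Proof. elim: u => //= x u ->; lia. Qed.

Lemma nth_morph (u : seq bool) k (b : bool) : k < size u ->
  nth false (morph u) (2 * k + b) = b (+) nth false u k.
Proof.
elim: u k => [|x u IHu] [|k] // lt_k_u; first by case: (b).
have -> : 2 * k.+1 + b = (2 * k + b).+2 by lia.
exact: IHu.
Qed.

Lemma TM_cat n : TM n.+2 = TM n.+1 ++ compl (TM n.+1).
Proof. by []. Qed.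

Lemma TM_morph n : 0 < n -> TM n.+1 = morph (TM n).
Proof.
case: n => // n _; elim: n => [//|n IHn].
by rewrite [TM n.+3]TM_cat [in RHS]TM_cat morph_cat morph_compl -IHn.
Qed.

Lemma size_TMS n : 0 < n -> size (TM n.+1) = 2 * size (TM n).
Proof. by move=> n_gt0; rewrite TM_morph // size_morph. Qed.

Lemma ltn_size_TM n : n < size (TM n.+1).
Proof. elim: n => // n IHn; rewrite size_TMS //; lia. Qed.

(** The 0-based infinite Thue-Morse word: each [TM n] is a prefix of the next, and [TM k.+1] is long
    enough to contain index [k], so the default is never reached. *)
Definition tm (k : nat) : bool := nth false (TM k.+1) k.

Lemma nth_TM n k : k < size (TM n) -> nth false (TM n) k = tm k.
Proof.
have extend m d j : j < size (TM m.+1) ->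
    nth false (TM (m + d).+1) j = nth false (TM m.+1) j.
  move=> lt_j; have lt_jd d' : j < size (TM (m + d').+1).
    elim: d' => [|d' IHd]; rewrite ?addn0 // addnS size_TMS //; lia.
  elim: d => [|d IHd]; first by rewrite addn0.
  by rewrite addnS TM_cat nth_cat lt_jd.
case: n => // n lt_k; have lt_kk := ltn_size_TM k.
have [le_nk | /ltnW le_kn] := leqP n k.
  by rewrite -(extend _ (k - n) _ lt_k) subnKC.
by rewrite -(subnKC le_kn) extend.
Qed.

Lemma tm_double k (b : bool) : tm (2 * k + b) = b (+) tm k.
Proof.
have lt_k := ltn_size_TM k.
rewrite -(nth_TM (n := k.+2)); last by rewrite size_TMS //; case: b; lia.
by rewrite TM_morph // nth_morph.
Qed.

(** One of [k], [k.+1] is even, so three consecutive positions contain a whole block, whose two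
    letters differ. *)
Lemma tm_cubefree k : ~ (tm k = tm k.+1 /\ tm k.+1 = tm k.+2).
Proof.
have neq m : tm (2 * m) <> tm (2 * m).+1.
  by have := (tm_double m true, tm_double m false); rewrite addn0 addn1;
     case=> -> ->; case: (tm m).
have [a] : exists a, k = 2 * a \/ k.+1 = 2 * a by exists (uphalf k); lia.
by case=> e [e1 e2]; apply: (neq a); rewrite -e.
Qed.

(** * Windows of the infinite word and synchronisation *)

Definition window (s l : nat) : seq bool := [seq tm k | k <- iota s l].

Lemma size_window s l : size (window s l) = l.
Proof. by rewrite size_map size_iota. Qed.

Lemma window_eqP s s' l :
  reflect (forall k, k < l -> tm (s + k) = tm (s' + k))
          (window s l == window s' l).
Proof.
apply: (iffP eqP) => [e k lt_kl | e].
  have := congr1 (nth false ^~ k) e.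
  by rewrite !(nth_map 0) ?size_iota // !nth_iota.
apply: (@eq_from_nth _ false); rewrite !size_window // => k lt_kl.
by rewrite !(nth_map 0) ?size_iota // !nth_iota // e.
Qed.

Lemma morph_window s l : morph (window s l) = window (2 * s) (2 * l).
Proof.
elim: l s => [|l IHl] s; first by rewrite muln0.
rewrite mulnS /window /= -!/(window _ _) IHl.
have := (tm_double s true, tm_double s false); rewrite addn0 addn1 => -[-> ->].
by rewrite mulnS.
Qed.

Lemma factor_TM n s l : s + l <= size (TM n) ->
  factor (TM n) s.+1 (s + l) = window s l.
Proof.
move=> le_sl; rewrite /factor.
have -> : s + l + 1 - s.+1 = l by lia.
have -> : s.+1 - 1 = s by lia.
have size_eq : size (take l (drop s (TM n))) = l.
  by rewrite size_takel // size_drop; lia.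
apply: (@eq_from_nth _ false); rewrite size_eq ?size_window // => k lt_kl.
rewrite nth_take // nth_drop nth_TM; last by lia.
by rewrite (nth_map 0) ?size_iota // nth_iota.
Qed.

(* At an odd offset, the letters of an even window of length 5 would force
   three equal consecutive letters in the desubstituted word. *)
Lemma window_sync s s' l : 5 <= l -> window s l == window s' l ->
  odd s = odd s'.
Proof.
move=> l_ge5.
have sync a c : ~ (forall k, k < 5 -> tm (2 * a + k) = tm (2 * c + 1 + k)).
  move=> e; apply: (@tm_cubefree a).
  have := (tm_double a false, tm_double a true, tm_double a.+1 false,
    tm_double a.+1 true, tm_double a.+2 false).
  have := (tm_double c true, tm_double c.+1 false, tm_double c.+1 true,
    tm_double c.+2 false, tm_double c.+2 true).
  have -> : 2 * c + true = 2 * c + 1 + 0 by lia.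
  have -> : 2 * c.+1 + false = 2 * c + 1 + 1 by lia.
  have -> : 2 * c.+1 + true = 2 * c + 1 + 2 by lia.
  have -> : 2 * c.+2 + false = 2 * c + 1 + 3 by lia.
  have -> : 2 * c.+2 + true = 2 * c + 1 + 4 by lia.
  have -> : 2 * a + false = 2 * a + 0 by lia.
  have -> : 2 * a + true = 2 * a + 1 by lia.
  have -> : 2 * a.+1 + false = 2 * a + 2 by lia.
  have -> : 2 * a.+1 + true = 2 * a + 3 by lia.
  have -> : 2 * a.+2 + false = 2 * a + 4 by lia.
  rewrite -!e //.
  move=> [[[[-> ->] ->] ->] ->] [[[[]]]].
  by case: (tm a) (tm a.+1) (tm a.+2) (tm c) (tm c.+1) (tm c.+2)
    => [] [] [] [] [] [].
move/window_eqP => e.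
have [//|] := eqVneq (odd s) (odd s').
case odd_s: (odd s); case odd_s': (odd s') => // _; exfalso.
- apply: (sync s'./2 s./2) => k lt_k.
  have -> : 2 * s'./2 + k = s' + k by lia.
  have -> : 2 * s./2 + 1 + k = s + k by lia.
  by rewrite e //; lia.
- apply: (sync s./2 s'./2) => k lt_k.
  have -> : 2 * s'./2 + 1 + k = s' + k by lia.
  have -> : 2 * s./2 + k = s + k by lia.
  by rewrite e //; lia.
Qed.

Lemma window_double a c m :
  (window (2 * a) (2 * m) == window (2 * c) (2 * m))
  = (window a m == window c m).
Proof.
apply/window_eqP/window_eqP => e k lt_k.
  have := e (2 * k); rewrite -!mulnDr.
  have := (tm_double (a + k) false, tm_double (c + k) false).
  by rewrite !addn0 => -[-> ->]; apply; lia.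
have -> : 2 * a + k = 2 * (a + k./2) + odd k by lia.
have -> : 2 * c + k = 2 * (c + k./2) + odd k by lia.
by rewrite !tm_double e //; lia.
Qed.

(** * Repeated windows *)

(* [s] is 0-based here, unlike in [is_occ] and [net_occ]. *)
Definition rep (N s l : nat) : bool :=
  has (fun s' => [&& s' != s, s' + l <= N & window s' l == window s l])
      (iota 0 N.+1).

Lemma repP N s l :
  reflect (exists s', [/\ s' != s, s' + l <= N & window s' l == window s l])
          (rep N s l).
Proof.
apply: (iffP hasP) => [[s' _ /and3P[]]|[s' [ne le e]]]; first by exists s'.
by exists s'; [rewrite mem_iota; lia | rewrite ne le].
Qed.

Lemma sub_rep N s l s1 l1 : s <= s1 -> s1 + l1 <= s + l ->
  rep N s l -> rep N s1 l1.
Proof.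
move=> le_s le_l /repP[s' [ne le /window_eqP e]]; apply/repP.
exists (s' + (s1 - s)); split; [lia | lia |].
apply/window_eqP => k lt_k; rewrite -addnA e; last by lia.
by rewrite addnA subnKC.
Qed.

(** By synchronisation both occurrences start with the second letter of a block, which determines
    the letter before it. *)
Lemma rep_left N a l : 5 <= l -> rep N (2 * a).+1 l -> rep N (2 * a) l.+1.
Proof.
move=> l_ge5 /repP[s' [ne le eqw]]; have par := window_sync l_ge5 eqw.
have {par} [c es'] : exists c, s' = (2 * c).+1 by exists s'./2; lia.
rewrite {}es' in ne le eqw; move/window_eqP: eqw => e.
apply/repP; exists (2 * c); split; [lia | lia |].
apply/window_eqP => -[_|k lt_k]; last by rewrite !addnS -!addSn e.
have := e 0; rewrite !addn0.
have := (tm_double a true, tm_double c true, tm_double a false,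
  tm_double c false).
rewrite !addn0 !addn1 => -[[[-> ->] ->] ->] h.
by apply: negb_inj; apply: h; lia.
Qed.

(** Both occurrences end with the first letter of a block, which determines the next letter. The
    other one still has room to grow: its end [s' + l] is odd, hence differs from [2 * N]. *)
Lemma rep_right N s l : 5 <= l -> odd (s + l) ->
  rep (2 * N) s l -> rep (2 * N) s l.+1.
Proof.
move=> l_ge5 odd_sl /repP[s' [ne le eqw]]; have par := window_sync l_ge5 eqw.
move/window_eqP: eqw => e.
apply/repP; exists s'; split; [lia | lia |].
apply/window_eqP => k; rewrite ltnS leq_eqVlt => /orP[/eqP->|/e //].
have last x : odd (x + l) -> tm (x + l) = ~~ tm (x + l.-1).
  move=> odd_xl; have := (tm_double (x + l)./2 true, tm_double (x + l)./2 false).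
  have -> : 2 * (x + l)./2 + true = x + l by lia.
  have -> : 2 * (x + l)./2 + false = x + l.-1 by lia.
  by case=> -> ->.
by rewrite !last ?e //; lia.
Qed.

Lemma rep_double N a m : 3 <= m -> rep (2 * N) (2 * a) (2 * m) = rep N a m.
Proof.
move=> m_ge3; apply/repP/repP => -[s' [ne le eqw]].
  have par : odd s' = odd (2 * a) by apply: window_sync eqw; lia.
  have es' : s' = 2 * s'./2 by lia.
  exists s'./2; split; [lia | lia |].
  by rewrite -window_double -es'.
by exists (2 * s'); split; [lia | lia | rewrite window_double].
Qed.

Lemma rep3 N s : 16 <= N -> rep N s 3.
Proof.
move=> N_ge16.
(* Two starts of the same factor inside the first 16 letters suffice, since at least one of them
   differs from [s]. The pairs given below are read off from [TM 5]. *)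
have twice p q : p != q -> p <= 13 -> q <= 13 ->
    window p 3 = window s 3 -> window q 3 = window s 3 -> rep N s 3.
  move=> ne lep leq ep eq; apply/repP.
  have [e|nep] := eqVneq p s.
    by exists q; split; [rewrite -e eq_sym | lia | rewrite eq].
  by exists p; split; [ | lia | rewrite ep].
have := @tm_cubefree s; move: twice; rewrite {2 4}/window /=.
case: (tm s) (tm s.+1) (tm s.+2) => [] [] [] twice nc.
- by case: nc.
- exact: (twice 1 7).
- exact: (twice 2 11).
- exact: (twice 4 8).
- exact: (twice 0 6).
- exact: (twice 3 10).
- exact: (twice 5 9).
- by case: nc.
Qed.

Lemma rep_le3 N s l : 16 <= N -> l <= 3 -> rep N s l.
Proof. by move=> N_ge16 le_l; apply: sub_rep (rep3 s N_ge16); lia. Qed.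

(** Such a window lies inside the three blocks that start at [2 * s./2], the image of a repeated
    window of length 3. *)
Lemma rep_le5 N s l : 16 <= N -> l <= 5 -> rep (2 * N) s l.
Proof.
move=> N_ge16 le_l; have := rep3 s./2 N_ge16.
by rewrite -rep_double //; apply: sub_rep; lia.
Qed.

(** * Net windows and their doubling *)

Definition net (N s l : nat) : bool :=
  [&& 0 < l, s + l <= N, rep N s l, (s == 0) || ~~ rep N s.-1 l.+1
    & (s + l == N) || ~~ rep N s l.+1].

(** If [l < b], both one-letter extensions are short enough to be repeated, so the window must touch
    both borders; then [l = N], against [b < N]. *)
Lemma net_long N s l b : b < N -> (forall s' l', l' <= b -> rep N s' l') ->
  net N s l -> b <= l.
Proof.
move=> lt_b short /and5P[l_gt0 le_sl _ left right]; rewrite leqNgt.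
apply/negP => lt_l; move: left right; rewrite !short // !orbF; lia.
Qed.

Lemma net_double N a m : 16 <= N ->
  net (2 * N) (2 * a) (2 * m) = net N a m.
Proof.
(* For [m < 3] both sides fail by [net_long], with bounds 5 and 3. Otherwise a one-letter extension
   is repeated exactly when the extension by the whole block is. *)
move=> N_ge16; have [m_ge3 | m_lt3] := leqP 3 m; last first.
  apply/idP/idP => h; exfalso.
    have : 5 <= 2 * m by apply: net_long h => [|*]; [lia | exact: rep_le5].
    by lia.
  have : 3 <= m by apply: net_long h => [|*]; [lia | exact: rep_le3].
  by lia.
rewrite /net rep_double // -mulnDr leq_pmul2l // muln_gt0 muln_eq0 /=.
rewrite eqn_pmul2l //; congr [&& _, _, _, _ & _].
- case: a => [//|a]; congr (~~ _); rewrite -[in RHS]rep_double; last by lia.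
  have -> : (2 * a.+1).-1 = (2 * a).+1 by lia.
  have -> : 2 * m.+1 = (2 * m).+2 by lia.
  by apply/idP/idP => [/rep_left->//|]; [lia | apply: sub_rep; lia].
- congr (_ || ~~ _); rewrite -[in RHS]rep_double; last by lia.
  have -> : 2 * m.+1 = (2 * m).+2 by lia.
  by apply/idP/idP => [/rep_right->//|]; [lia | lia | apply: sub_rep; lia].
Qed.

Lemma net_even N s l : 16 <= N -> net (2 * N) s l -> ~~ odd s && ~~ odd l.
Proof.
move=> N_ge16 net_sl.
have l_ge5 : 5 <= l by apply: net_long net_sl => [|*]; [lia | exact: rep_le5].
case/and5P: net_sl => _ le_sl rep_sl left right.
have even_s : ~~ odd s.
  apply/negP => odd_s; have es : s = (2 * s./2).+1 by lia.
  by move: left; rewrite es rep_left // -es.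
have [odd_l | //] := boolP (odd l); last by rewrite even_s.
have odd_sl : odd (s + l) by rewrite oddD odd_l (negbTE even_s).
by move: right; rewrite rep_right // orbF; lia.
Qed.

(** * From position pairs to windows *)

Lemma mem_occs T U i j : ((i, j) \in occs T U) = is_occ T U i j.
Proof.
rewrite mem_filter /=; apply: andb_idr => /and4P[i1 ij jT _].
by apply/allpairsP; exists (i, j); rewrite !mem_iota /=; split=> //; lia.
Qed.

Lemma mem_net_occs T i j : ((i, j) \in net_occs T) = net_occ T i j.
Proof.
rewrite mem_filter /=; apply: andb_idr => /and4P[i1 ij jT _].
by apply/allpairsP; exists (i, j); rewrite !mem_iota /=; split=> //; lia.
Qed.

Lemma uniq_position_pairs T : uniq (position_pairs T).
Proof. by apply: allpairs_uniq; rewrite ?iota_uniq // => -[? ?] [? ?]. Qed.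

Lemma is_occ_window n U s l :
  is_occ (TM n) U s.+1 (s + l)
  = [&& 0 < l, s + l <= size (TM n) & window s l == U].
Proof.
rewrite /is_occ (_ : (s < s + l) = (0 < l)); last by lia.
by case: (0 < l) => //=; have [le|//] := boolP (_ <= _); rewrite factor_TM.
Qed.

Lemma nb_occ_window n s l : 0 < l -> s + l <= size (TM n) ->
  (2 <= nb_occ (TM n) (window s l)) = rep (size (TM n)) s l
  /\ (nb_occ (TM n) (window s l) == 1) = ~~ rep (size (TM n)) s l.
Proof.
move=> l_gt0 le_sl; rewrite /nb_occ; set O := occs _ _.
have uniqO : uniq O by rewrite filter_uniq ?uniq_position_pairs.
have sO : (s.+1, s + l) \in O by rewrite mem_occs is_occ_window l_gt0 le_sl /=.
have O_gt0 : 0 < size O by case: (O) sO.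
(* As [O] is nonempty, having size 1 is the negation of having size at least 2. *)
suff <- : (2 <= size O) = rep (size (TM n)) s l by split=> //; lia.
apply/idP/repP => [O_ge2 | [s' [ne le' eqw]]].
  have /hasP[[i j] ijO ne] : has (predC1 (s.+1, s + l)) O.
    rewrite has_predC; apply/negP => /allP allO.
    suff : size O <= size [:: (s.+1, s + l)] by rewrite leqNgt O_ge2.
    by apply: uniq_leq_size => // x /allO; rewrite inE.
  move: ijO ne; rewrite mem_occs.
  case: i => [//|s'] occ; have lt : s' < j by case/and4P: occ.
  move: occ; rewrite -(subnKC (ltnW lt)); move: (j - s') => l'.
  rewrite is_occ_window => /and3P[_ le eqw].
  have el : l' = l by have := congr1 size (eqP eqw); rewrite !size_window.
  rewrite {}el in le eqw *; rewrite /= => ne; exists s'; split=> //.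
  by apply: contraNneq ne => ->.
have -> : 2 = size [:: (s.+1, s + l); (s'.+1, s' + l)] by [].
apply: uniq_leq_size => [|x].
  by rewrite /= inE xpair_eqE eqSS eq_sym (negbTE ne).
rewrite !inE => /orP[] /eqP-> //.
by rewrite mem_occs is_occ_window l_gt0 le' eqw.
Qed.

Lemma net_occ_window n s l :
  net_occ (TM n) s.+1 (s + l) = net (size (TM n)) s l.
Proof.
rewrite /net_occ /net (_ : (s < s + l) = (0 < l)) /=; last by lia.
have [l_gt0|//] := boolP (0 < l); have [le_sl|//] := boolP (s + l <= _) => /=.
rewrite factor_TM // (nb_occ_window l_gt0 le_sl).1; congr [&& _, _ & _].
  case: s le_sl => [//|s] le_sl; rewrite subn1 /= addSnnS factor_TM -?addSnnS //.
  by rewrite (nb_occ_window _ _).2 // -addSnnS.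
have [->//|ne] := eqVneq (s + l) (size (TM n)).
have le_slS : s + l.+1 <= size (TM n) by lia.
by rewrite addn1 -addnS factor_TM // (nb_occ_window _ le_slS).2 // (negbTE ne).
Qed.

(** * Doubling of occurrence lists *)

(** In 1-based positions, letter [k] becomes the block at [2k - 1] and [2k]. *)
Definition dbl (ij : nat * nat) : nat * nat := (2 * ij.1 - 1, 2 * ij.2).

(** Shared by net occurrences and occurrences of a fixed word: when [B] contains only unions of
    blocks, halving the 0-based start and the end inverts [dbl] on it. *)
Lemma mem_dbl (A B : seq (nat * nat)) :
    (forall i j, (i, j) \in A -> 0 < i <= j) ->
    (forall i j, (i, j) \in B -> 0 < i <= j) ->
    (forall s l, (s.+1, s + l) \in B -> ~~ odd s && ~~ odd l) ->
    (forall a m, ((2 * a).+1, 2 * a + 2 * m) \in B = ((a.+1, a + m) \in A)) ->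
  B =i [seq dbl ij | ij <- A].
Proof.
move=> posA posB evenB dblB [i j]; apply/idP/mapP => [ijB | [[i' j'] ijA]].
  have ij := posB _ _ ijB; exists ((i.-1)./2.+1, j./2); last first.
    have := evenB i.-1 (j - i.-1); rewrite prednK; last by lia.
    rewrite subnKC; last by lia.
    by move=> /(_ ijB) ev; rewrite /dbl /=; congr (_, _); lia.
  have := evenB i.-1 (j - i.-1); rewrite prednK; last by lia.
  rewrite subnKC; last by lia.
  move=> /(_ ijB) ev; have := dblB (i.-1)./2 (j./2 - (i.-1)./2).
  have -> : (2 * (i.-1)./2).+1 = i by lia.
  have -> : 2 * (i.-1)./2 + 2 * (j./2 - (i.-1)./2) = j by lia.
  by rewrite ijB subnKC; [move=> <- | lia].
have ij := posA _ _ ijA => -[-> ->].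
have -> : 2 * i' - 1 = (2 * i'.-1).+1 by lia.
have -> : 2 * j' = 2 * i'.-1 + 2 * (j' - i'.-1) by lia.
rewrite dblB subnKC ?prednK //; lia.
Qed.

Lemma size_TM_ge16 n : 5 <= n -> 16 <= size (TM n).
Proof.
elim: n => // n IHn; rewrite leq_eqVlt => /orP[/eqP <- // | n_ge5].
by rewrite size_TMS; have := IHn n_ge5; lia.
Qed.

Lemma net_occs_double n : 5 <= n ->
  net_occs (TM n.+1) =i [seq dbl ij | ij <- net_occs (TM n)].
Proof.
move=> n_ge5; have N_ge16 := size_TM_ge16 n_ge5.
have szS : size (TM n.+1) = 2 * size (TM n) by rewrite size_TMS //; lia.
apply: mem_dbl => [i j | i j | s l | a m]; rewrite !mem_net_occs.
- by case/and3P=> -> ->.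
- by case/and3P=> -> ->.
- by rewrite net_occ_window szS; apply: net_even.
- by rewrite !net_occ_window szS net_double.
Qed.

Lemma occs_double n p m : 0 < n -> 3 <= m ->
  occs (TM n.+1) (morph (window p m))
  =i [seq dbl ij | ij <- occs (TM n) (window p m)].
Proof.
move=> n_gt0 m_ge3.
apply: mem_dbl => [i j | i j | s l | a l]; rewrite !mem_occs.
- by case/and3P=> -> ->.
- by case/and3P=> -> ->.
- rewrite morph_window is_occ_window => /and3P[_ _ eqw].
  have el : l = 2 * m by have := congr1 size (eqP eqw); rewrite !size_window.
  rewrite {}el in eqw *.
  have -> : odd s = odd (2 * p) by apply: window_sync eqw; lia.
  by rewrite !oddM.
- rewrite !is_occ_window morph_window size_TMS // -mulnDr leq_pmul2l //.
  rewrite muln_gt0 /=; congr [&& _, _ & _].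
  have [->|ne] := eqVneq l m; first by rewrite window_double.
  apply/eqP/eqP => /(congr1 size); rewrite !size_window => e; lia.
Qed.

(** * The words of [P_set] and induction from [TM 5] *)

Lemma P_setS n : 5 <= n -> P_set n.+1 = [seq morph U | U <- P_set n].
Proof.
move=> n_ge5; rewrite /P_set !subSn; try lia.
by rewrite [RHS]/= !morph_cat !morph_compl !TM_morph //; lia.
Qed.

(** Puts the words in the form required by [occs_double]. The starts 0, 4, 3, 2 are occurrences in
    [TM 5], and the morphism doubles start and length. *)
Lemma P_set_window n U : 5 <= n -> U \in P_set n ->
  exists p m, 3 <= m /\ U = window p m.
Proof.
elim: n U => // n IHn U; rewrite leq_eqVlt => /orP[/eqP [<-] | n_ge5].
  rewrite !inE => /or4P[] /eqP->.
  - by exists 0, 4.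
  - by exists 4, 4.
  - by exists 3, 3.
  - by exists 2, 3.
rewrite P_setS // => /mapP[V /IHn[//|p [m [m_ge3 ->]]] ->].
by exists (2 * p), (2 * m); rewrite morph_window; split=> //; lia.
Qed.

Lemma occs_P_setS n U : 5 <= n -> U \in P_set n ->
  occs (TM n.+1) (morph U) =i [seq dbl ij | ij <- occs (TM n) U].
Proof.
move=> n_ge5 /(P_set_window n_ge5)[p [m [m_ge3 ->]]].
by apply: occs_double => //; lia.
Qed.

Lemma mem_net_occs_P_set n ij : 5 <= n ->
  (ij \in net_occs (TM n)) = has (fun U => ij \in occs (TM n) U) (P_set n).
Proof.
elim: n ij => // n IHn ij; rewrite leq_eqVlt => /orP[/eqP [<-] | n_ge5].
  have -> : net_occs (TM 5) = [:: (1, 4); (3, 5); (4, 6); (5, 8); (7, 10);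
    (9, 12); (11, 13); (12, 14); (13, 16)] by vm_compute.
  rewrite /P_set /has.
  have -> : occs (TM 5) (TM (5 - 2)) = [:: (1, 4); (7, 10); (13, 16)]
    by vm_compute.
  have -> : occs (TM 5) (compl (TM (5 - 2))) = [:: (5, 8); (9, 12)]
    by vm_compute.
  have -> : occs (TM 5) (TM (5 - 4) ++ compl (TM (5 - 3)))
    = [:: (4, 6); (11, 13)] by vm_compute.
  have -> : occs (TM 5) (compl (TM (5 - 4)) ++ TM (5 - 3))
    = [:: (3, 5); (12, 14)] by vm_compute.
  (* Both sides are disjunctions over the same nine pairs in different orders. *)
  by rewrite !inE; do 9!case: (ij == _).
rewrite net_occs_double // P_setS //; apply/mapP/hasP.
  case=> ij0; rewrite IHn // => /hasP[U PU occ] ->.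
  exists (morph U); first exact: map_f.
  by rewrite occs_P_setS // map_f.
case=> _ /mapP[U PU ->]; rewrite occs_P_setS // => /mapP[ij0 occ ->].
by exists ij0; rewrite ?IHn //; apply/hasP; exists U.
Qed.

Lemma startsS n U (L L' : seq nat) : 5 <= n -> U \in P_set n ->
    L' = [seq 2 * x - 1 | x <- L] ->
  starts (TM n) U =i L -> starts (TM n.+1) (morph U) =i L'.
Proof.
move=> n_ge5 PU -> eqL x.
rewrite (eq_mem_map fst (occs_P_setS n_ge5 PU)) -map_comp.
have -> : [seq (fst \o dbl) ij | ij <- occs (TM n) U]
  = [seq 2 * y - 1 | y <- starts (TM n) U] by rewrite -map_comp.
exact: eq_mem_map.
Qed.

(** The lists are duplicate-free and [dbl] is injective on net occurrences, so the count computed in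
    [TM 5] persists. *)
Lemma size_net_occs n : 5 <= n -> size (net_occs (TM n)) = 9.
Proof.
elim: n => // n IHn; rewrite leq_eqVlt => /orP[/eqP [<-] | n_ge5].
  by vm_compute.
rewrite -(IHn n_ge5) -(size_map dbl (net_occs (TM n))).
have uniq_net k : uniq (net_occs (TM k)).
  by rewrite filter_uniq ?uniq_position_pairs.
apply/perm_size/uniq_perm => //; last exact: net_occs_double.
rewrite map_inj_in_uniq // => -[i j] [i' j'] /=.
rewrite !mem_net_occs => /andP[i_gt0 _] /andP[i'_gt0 _] [ei ej].
by congr (_, _); lia.
Qed.

Lemma tauS n : 0 < n -> tau n.+1 = 2 * tau n.
Proof. exact: size_TMS. Qed.

(** The map [x -> 2x - 1] sends [t + 1] to [2t + 1], and every [tau] involved doubles, so the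
    formulas pass from [n] to [n.+1]. *)
Lemma starts_P_set n : 5 <= n ->
  [/\ starts (TM n) (TM (n - 2)) =i
       [:: 1; tau (n - 2) + tau (n - 3) + 1; tau (n - 1) + tau (n - 2) + 1],
      starts (TM n) (compl (TM (n - 2))) =i
       [:: tau (n - 2) + 1; tau (n - 1) + 1],
      starts (TM n) (TM (n - 4) ++ compl (TM (n - 3))) =i
       [:: tau (n - 3) + tau (n - 4) + 1; tau (n - 1) + tau (n - 3) + 1]
    & starts (TM n) (compl (TM (n - 4)) ++ TM (n - 3)) =i
       [:: tau (n - 3) + 1; tau (n - 1) + tau (n - 3) + tau (n - 4) + 1]].
Proof.
elim: n => // n IHn; rewrite leq_eqVlt => /orP[/eqP[<-] | n_ge5].
  by split=> x; congr (x \in _); vm_compute.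
have [s1 s2 s3 s4] := IHn n_ge5.
have eTM c : c <= 4 -> TM (n.+1 - c) = morph (TM (n - c)).
  by move=> c_le4; rewrite subSn ?TM_morph //; lia.
have etau c : c <= 4 -> tau (n.+1 - c) = 2 * tau (n - c).
  by move=> c_le4; rewrite subSn ?tauS //; lia.
(* Decreasing order: [n - c] and [n.+1 - c.+1] are convertible, so the right-hand
   sides would otherwise be rewritten again. *)
rewrite (eTM 4) // (eTM 3) // (eTM 2) // (etau 4) // (etau 3) // (etau 2) //.
rewrite (etau 1) // -!morph_compl -!morph_cat.
split; [apply: (startsS _ _ _ s1) | apply: (startsS _ _ _ s2)
       | apply: (startsS _ _ _ s3) | apply: (startsS _ _ _ s4)];
  rewrite // /P_set ?inE ?eqxx ?orbT //=;
  by do ![congr (_ :: _)]; lia.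
Qed.

Theorem theorem40 (n : nat) (hn : 5 <= n) :
  (forall i j : nat,
     net_occ (TM n) i j <->
     exists S : seq bool, S \in P_set n /\ is_occ (TM n) S i j)
  /\ starts (TM n) (TM (n - 2)) =i
       [:: 1; tau (n - 2) + tau (n - 3) + 1; tau (n - 1) + tau (n - 2) + 1]
  /\ starts (TM n) (compl (TM (n - 2))) =i
       [:: tau (n - 2) + 1; tau (n - 1) + 1]
  /\ starts (TM n) (TM (n - 4) ++ compl (TM (n - 3))) =i
       [:: tau (n - 3) + tau (n - 4) + 1; tau (n - 1) + tau (n - 3) + 1]
  /\ starts (TM n) (compl (TM (n - 4)) ++ TM (n - 3)) =i
       [:: tau (n - 3) + 1; tau (n - 1) + tau (n - 3) + tau (n - 4) + 1]
  /\ size (net_occs (TM n)) = 9.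
Proof.
split=> [i j|].
  rewrite -mem_net_occs mem_net_occs_P_set //.
  split=> [/hasP[U PU] | [U [PU occ]]].
    by rewrite mem_occs; exists U.
  by apply/hasP; exists U; rewrite ?mem_occs.
by case: (starts_P_set hn) => s1 s2 s3 s4; do 4!split=> //;
  exact: size_net_occs.
Qed.
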